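(* For a bounded distance tariff, a cheapest standard ticket and a cheapest ticket between any two stations can be computed in polynomial time.
   Context: A PTN is a finite, simple, connected, undirected graph $(V,E)$, here with a positive physical length assigned to each edge. A path is a finite sequence of (not necessarily distinct) nodes with consecutive nodes adjacent; $\mathcal{W}$ is the set of all paths; $l(W)$ is the sum of the edge lengths along $W$. A fare structure is a function $p:\mathcal{W}\to\mathbb{R}_{\ge 0}$. A bounded distance tariff is the combination of a distance tariff with affine price function, $p_1(W)=f+\overline{p}_1\cdot l(W)$ with $f\ge 0$ and $\overline{p}_1>0$, and a flat tariff $p_2(W)=\overline{p}_2\ge 0$; i.e. $p(W)=\min\{f+\overline{p}_1\, l(W),\ \overline{p}_2\}$ for all $W\in\mathcal{W}$. A ticket of $W\in\mathcal{W}$ is a finite sequence of paths $T=(H_1,\dots,H_t)$ such that $W$ is a concatenation $W_1+\dots+W_t$ of subpaths with $W_j$ a subpath of $H_j$ for each $j$; its price is $\sum_{j=1}^t p(H_j)$. The standard ticket of $W$ is $(W)$. A cheapest ticket (resp. cheapest standard ticket) from $x$ to $y$ is one of minimum price among all tickets (resp. standard tickets) of all $x$-$y$-paths. *)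

(* Defs.v *)
From mathcomp Require Import all_boot all_order all_algebra.
From mathcomp Require Import reals.

Set Implicit Arguments.
Unset Strict Implicit.
Unset Printing Implicit Defensive.

Import Order.TTheory GRing.Theory Num.Theory.
Local Open Scope ring_scope.

(** * Public transport networks, fares and tickets *)

(* Only the values of [len] on edges are meaningful. *)
Record ptn (V : finType) (K : realFieldType) := Ptn {
  adj : rel V;
  adj_sym : symmetric adj;
  adj_irr : irreflexive adj;
  adj_connected : forall u v : V, connect adj u v;
  len : V -> V -> K;
  len_sym : forall u v : V, len u v = len v u;
  len_gt0 : forall u v : V, adj u v -> 0 < len u v
}.

Section Fares.
Variables (V : finType) (K : realFieldType) (G : ptn V K).

(* A path is a nonempty sequence of nodes; one-node paths, of length 0, are
   allowed. *)
Definition is_path (W : seq V) : bool :=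
  if W is u :: W' then path (adj G) u W' else false.

Definition path_from_to (u v : V) (W : seq V) : bool :=
  [&& is_path W, head u W == u & last u W == v].

Definition path_len (W : seq V) : K :=
  \sum_(e <- zip W (behead W)) len G e.1 e.2.

Record bounded_distance_params := BoundedDistanceParams {
  base_price : K;
  price_per_unit : K;
  flat_price : K;
  base_price_ge0 : 0 <= base_price;
  price_per_unit_gt0 : 0 < price_per_unit;
  flat_price_ge0 : 0 <= flat_price
}.

Definition affine_distance_tariff (f c : K) (W : seq V) : K :=
  f + c * path_len W.

Definition flat_tariff (c : K) (W : seq V) : K := c.

Definition bounded_distance_tariff (t : bounded_distance_params) (W : seq V) : K :=
  Num.min (affine_distance_tariff (base_price t) (price_per_unit t) W)
          (flat_tariff (flat_price t) W).

(* [is_concat Ws W]: W = W_1 + ... + W_t with t >= 1, where the sum of two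
   paths is defined when the first one ends at the node at which the second
   one starts, and this node is kept only once. *)
Inductive is_concat : seq (seq V) -> seq V -> Prop :=
| Concat1 (W : seq V) : is_concat [:: W] W
| ConcatS (W1 : seq V) (z : V) (W2 : seq V) (Ws : seq (seq V)) :
    is_concat Ws (z :: W2) -> is_concat (rcons W1 z :: Ws) (W1 ++ z :: W2).

Definition is_ticket (T : seq (seq V)) (W : seq V) : Prop :=
  all is_path T /\
  exists Ws : seq (seq V),
    [/\ all is_path Ws, is_concat Ws W & all2 (fun Wj Hj => infix Wj Hj) Ws T].

Definition is_standard_ticket (T : seq (seq V)) (W : seq V) : Prop :=
  T = [:: W].

Definition ticket_price (p : seq V -> K) (T : seq (seq V)) : K :=
  \sum_(H <- T) p H.

Definition cheapest_among (ticket_of : seq (seq V) -> seq V -> Prop)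
    (p : seq V -> K) (x y : V) (T : seq (seq V)) : Prop :=
  (exists2 W, path_from_to x y W & ticket_of T W) /\
  forall (W' : seq V) (T' : seq (seq V)),
    path_from_to x y W' -> ticket_of T' W' -> ticket_price p T <= ticket_price p T'.

Definition cheapest_ticket := cheapest_among is_ticket.
Definition cheapest_standard_ticket := cheapest_among is_standard_ticket.

End Fares.

(** * A random access machine

   Programs are while-programs over two unbounded memories indexed by natural
   numbers: an integer memory (also used for indirect addressing) and a number
   memory with cells in an ordered field K.  Programs do not depend on K; the
   only constants of sort K are 0 and 1, and there is no rounding operation.

   Each evaluated (sub)expression is charged one plus the size of its value,
   where the size of a natural number is its bit length and the size of an
   element of K is given by a function [sz].  This yields
   - for K = rat and [sz] the bit size, the logarithmic cost criterion, under
     which polynomial time coincides with polynomial time on Turing machines;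
   - for K the reals and [sz] constantly 1, the algebraic (real RAM) model, in
     which each arithmetic operation or comparison of reals takes constant time. *)

Inductive iexp : Type :=
| IConst of nat
| ILoad of iexp
| IAdd of iexp & iexp
| ISub of iexp & iexp
| IMul of iexp & iexp.

Inductive nexp : Type :=
| NZero
| NOne
| NLoad of iexp
| NAdd of nexp & nexp
| NSub of nexp & nexp
| NMul of nexp & nexp
| NDiv of nexp & nexp.

Inductive bexp : Type :=
| BLtI of iexp & iexp
| BLtN of nexp & nexp
| BNot of bexp
| BAnd of bexp & bexp.

Inductive cmd : Type :=
| Skip
| IStore of iexp & iexp
| NStore of iexp & nexp
| Seq of cmd & cmd
| If of bexp & cmd & cmd
| While of bexp & cmd.

Definition bit_length (n : nat) : nat := (trunc_log 2 n).+1.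

Definition rat_bit_size (q : rat) : nat :=
  (bit_length `|numq q| + bit_length `|denq q|)%N.

Definition unit_size (K : realFieldType) (a : K) : nat := 1%N.

Definition upd (A : Type) (m : nat -> A) (i : nat) (a : A) : nat -> A :=
  fun j => if j == i then a else m j.

Section Machine.
Variables (K : realFieldType) (sz : K -> nat).

Record state := State { imem : nat -> nat; nmem : nat -> K }.

Fixpoint ieval (s : state) (e : iexp) : nat :=
  match e with
  | IConst n => n
  | ILoad a => imem s (ieval s a)
  | IAdd a b => (ieval s a + ieval s b)%N
  | ISub a b => (ieval s a - ieval s b)%N
  | IMul a b => (ieval s a * ieval s b)%N
  end.

Fixpoint icost (s : state) (e : iexp) : nat :=
  ((match e with
    | IConst _ => 0
    | ILoad a => icost s a
    | IAdd a b | ISub a b | IMul a b => icost s a + icost s b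
    end) + bit_length (ieval s e) + 1)%N.

Fixpoint neval (s : state) (e : nexp) : K :=
  match e with
  | NZero => 0
  | NOne => 1
  | NLoad a => nmem s (ieval s a)
  | NAdd a b => neval s a + neval s b
  | NSub a b => neval s a - neval s b
  | NMul a b => neval s a * neval s b
  | NDiv a b => neval s a / neval s b
  end.

Fixpoint ncost (s : state) (e : nexp) : nat :=
  ((match e with
    | NZero | NOne => 0
    | NLoad a => icost s a
    | NAdd a b | NSub a b | NMul a b | NDiv a b => ncost s a + ncost s b
    end) + sz (neval s e) + 1)%N.

Fixpoint beval (s : state) (e : bexp) : bool :=
  match e with
  | BLtI a b => (ieval s a < ieval s b)%N
  | BLtN a b => neval s a < neval s b
  | BNot a => ~~ beval s a
  | BAnd a b => beval s a && beval s b
  end.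

Fixpoint bcost (s : state) (e : bexp) : nat :=
  ((match e with
    | BLtI a b => icost s a + icost s b
    | BLtN a b => ncost s a + ncost s b
    | BNot a => bcost s a
    | BAnd a b => bcost s a + bcost s b
    end) + 1)%N.

(* [exec c s t s']: started in s, the program c halts in s' at cost t. *)
Inductive exec : cmd -> state -> nat -> state -> Prop :=
| ExecSkip s : exec Skip s 1 s
| ExecIStore s a e :
    exec (IStore a e) s (icost s a + icost s e + 1)
      (State (upd (imem s) (ieval s a) (ieval s e)) (nmem s))
| ExecNStore s a e :
    exec (NStore a e) s (icost s a + ncost s e + 1)
      (State (imem s) (upd (nmem s) (ieval s a) (neval s e)))
| ExecSeq c1 c2 s1 t1 s2 t2 s3 :
    exec c1 s1 t1 s2 -> exec c2 s2 t2 s3 -> exec (Seq c1 c2) s1 (t1 + t2 + 1) s3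
| ExecIf b c1 c2 s t s' :
    exec (if beval s b then c1 else c2) s t s' ->
    exec (If b c1 c2) s (bcost s b + t + 1) s'
| ExecWhileF b c s :
    ~~ beval s b -> exec (While b c) s (bcost s b + 1) s
| ExecWhileT b c s1 t1 s2 t2 s3 :
    beval s1 b -> exec c s1 t1 s2 -> exec (While b c) s2 t2 s3 ->
    exec (While b c) s1 (bcost s1 b + t1 + t2 + 1) s3.

End Machine.

(** * Computing tickets in polynomial time *)

Record instance (K : realFieldType) := Instance {
  nstations : nat;
  network : ptn 'I_nstations K;
  tariff : bounded_distance_params K;
  origin : 'I_nstations;
  destination : 'I_nstations
}.

Section Problems.
Variable K : realFieldType.

(* The edges are represented by an n x n matrix of numbers, a zero entry
   meaning that there is no edge. *)
Definition input_state (I : instance K) : state K :=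
  let n := nstations I in
  State
    (nth 0%N [:: n; val (origin I); val (destination I)])
    (nth 0 ([:: base_price (tariff I); price_per_unit (tariff I);
                flat_price (tariff I)]
            ++ [seq (if adj (network I) u v then len (network I) u v else 0)
               | u <- enum 'I_n, v <- enum 'I_n])).

Definition instance_size (sz : K -> nat) (I : instance K) : nat :=
  (nstations I
   + \sum_(u < nstations I) \sum_(v < nstations I | adj (network I) u v)
       sz (len (network I) u v)
   + sz (base_price (tariff I)) + sz (price_per_unit (tariff I))
   + sz (flat_price (tariff I)))%N.

(* A ticket is written as its number of paths followed, for each path, by its
   number of nodes and its nodes. *)
Definition encode_ticket (n : nat) (T : seq (seq 'I_n)) : seq nat :=
  size T :: flatten [seq size H :: map val H | H <- T].

Definition outputs (s : state K) (l : seq nat) : Prop :=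
  forall i, (i < size l)%N -> imem s i = nth 0%N l i.

Definition ticket_problem :=
  forall I : instance K, seq (seq 'I_(nstations I)) -> Prop.

Definition cheapest_ticket_problem : ticket_problem := fun I =>
  cheapest_ticket (network I)
    (bounded_distance_tariff (network I) (tariff I)) (origin I) (destination I).

Definition cheapest_standard_ticket_problem : ticket_problem := fun I =>
  cheapest_standard_ticket (network I)
    (bounded_distance_tariff (network I) (tariff I)) (origin I) (destination I).

Definition computable_in_polynomial_time (sz : K -> nat) (Pb : ticket_problem) :
    Prop :=
  exists (c : cmd) (q : {poly nat}), forall I : instance K,
    exists (T : seq (seq 'I_(nstations I))) (t : nat) (s : state K),
      [/\ Pb I T, exec sz c (input_state I) t s,
          outputs s (encode_ticket T) & (t <= q.[instance_size sz I])%N].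

End Problems.

(* Main.v *)
Require Import Defs.
From mathcomp Require Import all_boot all_order all_algebra.
From mathcomp Require Import reals.
From mathcomp Require Import zify lra.

Set Implicit Arguments.
Unset Strict Implicit.
Unset Printing Implicit Defensive.
Import Order.TTheory GRing.Theory Num.Theory.

(** A bounded distance tariff never rewards buying anything but the standard
    ticket of a shortest path.  The price is a nondecreasing function of the
    length, so that a shortest path has a cheapest standard ticket.  It is also
    subadditive under concatenation: splitting a path into parts pays the base
    price once for each part, and a single part charged at the flat price costs
    as much as the whole path ever can ([price_cat_le]).  As every part is
    contained in the path that its ticket was bought for, every ticket of [W]
    costs at least the price of [W] ([price_ticket_le]).  Both problems are
    therefore solved by one program that outputs the standard ticket of a
    shortest path.

    The program relaxes all pairs of nodes in place, [n] times over, as in the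
    Bellman-Ford algorithm directed towards the destination, and then follows the
    recorded successors from the origin.  Its effect on the labels is described by
    pure functions ([relax], [rounds]), about which everything combinatorial is
    proved: labels are lengths of paths ([sound]), they only improve
    ([improved]), and after [r] rounds they are at least as good as every path
    with at most [r] edges ([rounds_complete]).  Since edge lengths are positive, the
    distances strictly decrease along the successors, so that the path that is
    followed is simple ([runs_trace]).

    Polynomial time follows from a bound [X] on everything at once: if the
    integers in memory, the sizes of all numbers that occur, and the number of
    rounds of every loop are at most [X], then a program runs within a polynomial
    in [X] that depends on the program only ([cost_bound], [runs]).  It remains to
    bound the sizes of the numbers.  All those that are computed are lengths of
    paths with at most [n ^ 3] edges, one for each relaxation, and the size of a sum of [k]
    numbers is linear in the total size of its terms.  For rationals this holds
    because the absolute value of the numerator plus the denominator is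
    submultiplicative under addition ([rat_weightD]); for numbers of unit size
    there is nothing to bound. *)

(** * Running times *)

Lemma bit_length_leq (m : nat) : bit_length m <= m.+1.
Proof.
rewrite /bit_length ltnS; case: m => [|m]; first by rewrite trunc_log0.
by rewrite -(leq_exp2l (m := 2)) // (leq_trans (trunc_logP _ _)) // ltnW // ltn_expl.
Qed.

Section CostBounds.
Local Open Scope ring_scope.

Fixpoint ieval_bound (e : iexp) : {poly nat} :=
  match e with
  | IConst k => k%:P
  | ILoad _ => 'X
  | IAdd a b => ieval_bound a + ieval_bound b
  | ISub a _ => ieval_bound a
  | IMul a b => ieval_bound a * ieval_bound b
  end.

Fixpoint icost_bound (e : iexp) : {poly nat} :=
  (match e with
   | IConst _ => 0
   | ILoad a => icost_bound a
   | IAdd a b | ISub a b | IMul a b => icost_bound a + icost_bound b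
   end) + (ieval_bound e + 1) + 1.

Fixpoint ncost_bound (e : nexp) : {poly nat} :=
  (match e with
   | NZero | NOne => 0
   | NLoad a => icost_bound a
   | NAdd a b | NSub a b | NMul a b | NDiv a b => ncost_bound a + ncost_bound b
   end) + 'X + 1.

Fixpoint bcost_bound (e : bexp) : {poly nat} :=
  (match e with
   | BLtI a b => icost_bound a + icost_bound b
   | BLtN a b => ncost_bound a + ncost_bound b
   | BNot a => bcost_bound a
   | BAnd a b => bcost_bound a + bcost_bound b
   end) + 1.

(** The single variable stands for a common bound on the integers in memory, on
    the sizes of the numbers in memory and on the number of rounds of each
    execution of a loop. *)
Fixpoint cost_bound (c : cmd) : {poly nat} :=
  match c with
  | Skip => 1
  | IStore a e => icost_bound a + icost_bound e + 1
  | NStore a e => icost_bound a + ncost_bound e + 1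
  | Seq c1 c2 => cost_bound c1 + cost_bound c2 + 1
  | If b c1 c2 => bcost_bound b + (cost_bound c1 + cost_bound c2) + 1
  | While b c => ('X + 1) * (bcost_bound b + cost_bound c + 1)
  end.

End CostBounds.

(** The evaluation rules with the operations of nat in place of those of the
   semiring structure on nat. *)
Lemma horner_natE (X : nat) :
  (forall p q : {poly nat}, (p + q).[X]%R = p.[X]%R + q.[X]%R)
  * (forall p q : {poly nat}, (p * q).[X]%R = p.[X]%R * q.[X]%R)
  * (('X : {poly nat})%R.[X]%R = X) * ((0 : {poly nat})%R.[X]%R = 0)
  * ((1 : {poly nat})%R.[X]%R = 1) * (forall k : nat, (k%:P).[X]%R = k).
Proof.
by do !split=> *; rewrite ?(hornerD, hornerM, hornerX, hornerC, horner0).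
Qed.

Section Runs.
Variables (K : realFieldType) (sz : K -> nat) (X : nat).
Implicit Types (s : state K) (c : cmd) (Q : state K -> Prop).

Definition small s : Prop :=
  (forall a, imem s a <= X) /\ (forall a, sz (nmem s a) <= X).

(** Arithmetic on numbers can increase their sizes, so that a bound on the
    memory does not bound the sizes of the intermediate results: these are
    bounded separately. *)
Fixpoint nsmall s (e : nexp) : Prop :=
  sz (neval s e) <= X /\
  match e with
  | NZero | NOne | NLoad _ => True
  | NAdd a b | NSub a b | NMul a b | NDiv a b => nsmall s a /\ nsmall s b
  end.

Fixpoint bsmall s (e : bexp) : Prop :=
  match e with
  | BLtI _ _ => True
  | BLtN a b => nsmall s a /\ nsmall s b
  | BNot a => bsmall s a
  | BAnd a b => bsmall s a /\ bsmall s b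
  end.

(** Termination, the cost bound and the postcondition [Q] in one statement.  As
    [Q] may itself be of the form [runs _ _ _], programs are verified command by
    command, without any arithmetic on costs. *)
Definition runs c s Q : Prop :=
  exists t s', [/\ exec sz c s t s', t <= (cost_bound c).[X]%R & Q s'].

Lemma ieval_leq s e : small s -> ieval s e <= (ieval_bound e).[X]%R.
Proof.
move=> [sI _]; elim: e => [k|a _|a IHa b IHb|a IHa b IHb|a IHa b IHb] /=.
- by rewrite horner_natE.
- by rewrite horner_natE.
- by rewrite !horner_natE leq_add.
- by rewrite (leq_trans (leq_subr _ _)).
- by rewrite horner_natE leq_mul.
Qed.

Lemma icost_leq s e : small s -> icost s e <= (icost_bound e).[X]%R.
Proof.
move=> sS; elim: e => [k|a IHa|a IHa b IHb|a IHa b IHb|a IHa b IHb].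
- by have := ieval_leq (IConst k) sS; have := bit_length_leq k;
    rewrite /= ?horner_natE; lia.
- by have := ieval_leq (ILoad a) sS; have := bit_length_leq (ieval s (ILoad a));
    rewrite /= ?horner_natE; lia.
- by have := ieval_leq (IAdd a b) sS; have := bit_length_leq (ieval s (IAdd a b));
    rewrite /= ?horner_natE; lia.
- by have := ieval_leq (ISub a b) sS; have := bit_length_leq (ieval s (ISub a b));
    rewrite /= ?horner_natE; lia.
- by have := ieval_leq (IMul a b) sS; have := bit_length_leq (ieval s (IMul a b));
    rewrite /= ?horner_natE; lia.
Qed.

Lemma ncost_leq s e : small s -> nsmall s e -> ncost sz s e <= (ncost_bound e).[X]%R.
Proof.
move=> sS; elim: e => [||a|a IHa b IHb|a IHa b IHb|a IHa b IHb|a IHa b IHb];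
  rewrite [nsmall _ _]/= [ncost _ _ _]/= [ncost_bound _]/= !horner_natE .
1-3: by move=> [szX _]; rewrite ?leq_add ?icost_leq.
all: by move=> [szX [/IHa Ha /IHb Hb]]; rewrite ?leq_add.
Qed.

Lemma bcost_leq s e : small s -> bsmall s e -> bcost sz s e <= (bcost_bound e).[X]%R.
Proof.
move=> sS; elim: e => [a b|a b|a IHa|a IHa b IHb];
  rewrite [bsmall _ _]/= [bcost _ _ _]/= [bcost_bound _]/= !horner_natE .
- by rewrite !leq_add ?icost_leq.
- by move=> [Ha Hb]; rewrite !leq_add ?ncost_leq.
- by move=> /IHa Ha; rewrite leq_add.
- by move=> [/IHa Ha /IHb Hb]; rewrite !leq_add.
Qed.

Lemma runs_skip s Q : Q s -> runs Skip s Q.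
Proof. by exists 1, s; split=> //=; [constructor | rewrite horner_natE]. Qed.

Lemma runs_istore s a e Q : small s ->
  Q (State (upd (imem s) (ieval s a) (ieval s e)) (nmem s)) -> runs (IStore a e) s Q.
Proof.
move=> sS Qs; exists (icost s a + icost s e + 1); eexists; split; [constructor | | exact: Qs].
by rewrite /= !horner_natE !leq_add ?icost_leq.
Qed.

Lemma runs_nstore s a e Q : small s -> nsmall s e ->
  Q (State (imem s) (upd (nmem s) (ieval s a) (neval s e))) -> runs (NStore a e) s Q.
Proof.
move=> sS eS Qs; exists (icost s a + ncost sz s e + 1); eexists.
split; [constructor | | exact: Qs].
by rewrite /= !horner_natE !leq_add ?icost_leq ?ncost_leq.
Qed.

Lemma runs_seq c1 c2 s Q : runs c1 s (fun s' => runs c2 s' Q) -> runs (Seq c1 c2) s Q.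
Proof.
move=> [t1 [s1 [e1 l1 [t2 [s2 [e2 l2 Qs]]]]]]; exists (t1 + t2 + 1), s2.
by split=> //; [apply: ExecSeq e1 e2 | rewrite /= !horner_natE !leq_add].
Qed.

Lemma runs_if b c1 c2 s Q : small s -> bsmall s b ->
  runs (if beval s b then c1 else c2) s Q -> runs (If b c1 c2) s Q.
Proof.
move=> sS bS [t [s' [e l Qs]]]; exists (bcost sz s b + t + 1), s'.
split=> //; first exact: ExecIf e.
rewrite /= !horner_natE !leq_add ?bcost_leq //.
by case: (beval s b) l => l; rewrite (leq_trans l) ?leq_addl ?leq_addr.
Qed.

Lemma runs_weaken c s Q Q' : (forall s', Q s' -> Q' s') -> runs c s Q -> runs c s Q'.
Proof. by move=> QQ [t [s' [e l /QQ Qs]]]; exists t, s'. Qed.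

(** The index of the invariant counts the rounds; [N] bounds their number. *)
Lemma runs_while b c s Q (inv : nat -> state K -> Prop) (N : nat) : N <= X ->
  (forall i s', inv i s' -> small s' /\ bsmall s' b) ->
  (forall i s', inv i s' -> beval s' b -> i < N /\ runs c s' (inv i.+1)) ->
  (forall i s', inv i s' -> ~~ beval s' b -> Q s') ->
  inv 0 s -> runs (While b c) s Q.
Proof.
move=> NX invS invc invQ inv0.
set B := (bcost_bound b).[X]%R; set C := (cost_bound c).[X]%R.
have loop m i s' : m + i = N -> inv i s' ->
    exists t s2, [/\ exec sz (While b c) s' t s2, t <= m.+1 * (B + C + 1) & Q s2].
  elim: m i s' => [|m IHm] i s' def_m inv_i; have [sS bS] := invS _ _ inv_i;
    have := bcost_leq sS bS; rewrite -/B => Bb;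
    have [b_s|nb_s] := boolP (beval s' b).
  - by have [] := invc _ _ inv_i b_s; lia.
  - exists (bcost sz s' b + 1), s'; split; [exact: ExecWhileF | by nia | exact: (invQ _ _ inv_i)].
  - have [_ [t1 [s1 [e1]]]] := invc _ _ inv_i b_s; rewrite -/C => l1 inv1.
    have [|t2 [s2 [e2 l2 Qs]]] := IHm i.+1 s1 _ inv1; first lia.
    exists (bcost sz s' b + t1 + t2 + 1), s2; split=> //; first exact: ExecWhileT e1 e2.
    by nia.
  - exists (bcost sz s' b + 1), s'; split; [exact: ExecWhileF | by nia | exact: (invQ _ _ inv_i)].
have [t [s' [e l Qs]]] := loop N 0 s (addn0 _) inv0.
exists t, s'; split=> //; apply: leq_trans l _.
by rewrite /= !horner_natE -/B -/C leq_mul // addn1 ltnS.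
Qed.

End Runs.

(** * Shortest paths and cheapest tickets *)

Section Paths.
Variables (V : finType) (K : realFieldType) (G : ptn V K).
Local Open Scope ring_scope.
Implicit Types (u v z : V) (W H : seq V).

Lemma path_len1 u : path_len G [:: u] = 0.
Proof. by rewrite /path_len big_nil. Qed.

Lemma path_len_cons u v W :
  path_len G [:: u, v & W] = len G u v + path_len G (v :: W).
Proof. by rewrite /path_len big_cons. Qed.

Lemma path_len_cat W1 z W2 :
  path_len G (W1 ++ z :: W2) = path_len G (rcons W1 z) + path_len G (z :: W2).
Proof.
elim: W1 => [|u [|v W1] IH] /=; first by rewrite path_len1 add0r.
  by rewrite !path_len_cons path_len1 addr0.
by rewrite !path_len_cons -addrA -IH.
Qed.

Lemma path_len_rcons u W v :
  path_len G (rcons (u :: W) v) = path_len G (u :: W) + len G (last u W) v.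
Proof.
have: rcons (u :: W) v = belast u W ++ last u W :: [:: v].
  by rewrite -cat_rcons -lastI cats1.
by move->; rewrite path_len_cat -lastI path_len_cons path_len1 addr0.
Qed.

Lemma path_len_ge0 W : is_path G W -> 0 <= path_len G W.
Proof.
case: W => // u W; elim: W u => [|v W IH] u /=; first by rewrite path_len1.
by move=> /andP[uv /IH]; rewrite path_len_cons; apply: addr_ge0; rewrite ltW ?len_gt0.
Qed.

Lemma path_edges W : is_path G W -> {in zip W (behead W), forall e, adj G e.1 e.2}.
Proof.
case: W => // u W; elim: W u => [|v W IH] u //= /andP[uv /IH edges] e.
by rewrite inE => /predU1P[->|/edges].
Qed.

Lemma path_len_drop W1 W2 :
  is_path G (W1 ++ W2) -> is_path G W2 -> path_len G W2 <= path_len G (W1 ++ W2).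
Proof.
case: W2 => // z W2 pW _; rewrite path_len_cat lerDr path_len_ge0 //.
by case: W1 pW => // u W1 /=; rewrite cat_path rcons_path /= => /and3P[-> ->].
Qed.

Lemma path_len_take W1 W2 :
  is_path G (W1 ++ W2) -> is_path G W1 -> path_len G W1 <= path_len G (W1 ++ W2).
Proof.
case/lastP: W1 => // W1 z; rewrite cat_rcons path_len_cat lerDl => pW _.
apply: path_len_ge0; case: W1 pW => //= u W1.
by rewrite cat_path /= => /and3P[].
Qed.

Lemma path_len_infix W H :
  is_path G H -> is_path G W -> infix W H -> path_len G W <= path_len G H.
Proof.
move=> pH pW /infixP[H1 [H2 defH]]; subst H.
have pWH2 : is_path G (W ++ H2).
  case: H1 pH => //= u H1; case: W pW => //= w W _.
  by rewrite cat_path /= => /and3P[].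
exact: le_trans (path_len_take pWH2 pW) (path_len_drop pH pWH2).
Qed.

(** Removing a closed part from a path does not increase its length. *)
Lemma simple_path_leq u v W : path_from_to G u v W ->
  exists W', [/\ path_from_to G u v W', uniq W' & path_len G W' <= path_len G W].
Proof.
elim: W u => // a W IHW u /and3P[pW /eqP<- /= lW].
case: W IHW pW lW => [_ _ lW|b W IHW /= /andP[ab pW] lW].
  by exists [:: a]; split=> //; apply/and3P.
have pbW : path_from_to G b v (b :: W) by apply/and3P; split.
have [W' [pW' uW' leW']] := IHW b pbW.
have [aW'|aW'] := boolP (a \in W').
  have [W1 [W2 defW']] : exists W1 W2, W' = W1 ++ a :: W2.
    by case/splitPr: aW' => W1 W2; exists W1, W2.
  have pW2 : path_from_to G a v (a :: W2).
    move: pW'; rewrite defW' => /and3P[pW' _]; rewrite last_cat /= => lW'.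
    rewrite /path_from_to /= eqxx lW' !andbT.
    by case: W1 pW' {defW' lW'} => //= a1 W1; rewrite cat_path /= => /and3P[].
  exists (a :: W2); split=> //; first by move: uW'; rewrite defW' cat_uniq => /and3P[].
  apply: (@le_trans _ _ (path_len G W')).
    by rewrite defW'; apply: path_len_drop; [rewrite -defW'; case/and3P: pW' | case/and3P: pW2].
  by rewrite path_len_cons (le_trans leW') // lerDr ltW ?len_gt0.
exists (a :: W'); case: W' pW' uW' leW' aW' => // c W' /and3P[pW' /= /eqP cb lW'] uW' leW' aW'.
rewrite cb in pW' lW' uW' leW' aW' *; split.
- by apply/and3P; split; rewrite //= ab.
- by rewrite /= aW'.
- by rewrite !path_len_cons lerD2l.
Qed.

Definition shortest_path u v W : Prop :=
  path_from_to G u v W /\ forall W', path_from_to G u v W' -> path_len G W <= path_len G W'.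

Section Tariff.
Variable t : bounded_distance_params K.
Let p := bounded_distance_tariff G t.

Lemma price_le W W' : path_len G W <= path_len G W' -> p W <= p W'.
Proof.
move=> leW; have c0 := price_per_unit_gt0 t.
rewrite /p /bounded_distance_tariff /affine_distance_tariff /flat_tariff.
have cW : price_per_unit t * path_len G W <= price_per_unit t * path_len G W'.
  by rewrite ler_pM2l.
by rewrite !minEle; do 2!case: ifP => ?; lra.
Qed.

(** Splitting a path duplicates the base price, and a part charged at the flat
    price is already as expensive as the whole path. *)
Lemma price_cat_le W1 z W2 : is_path G (rcons W1 z) -> is_path G (z :: W2) ->
  p (W1 ++ z :: W2) <= p (rcons W1 z) + p (z :: W2).
Proof.
move=> /path_len_ge0 l1 /path_len_ge0 l2.
rewrite /p /bounded_distance_tariff /affine_distance_tariff /flat_tariff path_len_cat mulrDr.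
have c0 := ltW (price_per_unit_gt0 t).
have := mulr_ge0 c0 l1; have := mulr_ge0 c0 l2.
have := base_price_ge0 t; have := flat_price_ge0 t.
by rewrite !minEle => *; do 3!case: ifP => ?; lra.
Qed.

Lemma price_concat_le Ws W : is_concat Ws W -> all (is_path G) Ws ->
  is_path G W /\ p W <= \sum_(H <- Ws) p H.
Proof.
elim=> {Ws W} [W|W1 z W2 Ws _ IH] /=.
  by rewrite andbT big_cons big_nil addr0.
move=> /andP[pW1 /IH[pW2 leW2]]; split.
  by move: pW2 pW1; case: W1 => //= u W1 pW2; rewrite cat_path rcons_path /= => /andP[-> ->].
by rewrite big_cons (le_trans (price_cat_le pW1 pW2)) // lerD2l.
Qed.

(** A part of a ticket is at least as long as the part of the path that it
    covers, and the prices of the covered parts add up to at least the price of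
    the path. *)
Lemma price_ticket_le T W : is_ticket G T W -> p W <= ticket_price p T.
Proof.
move=> [pT [Ws [pWs cW]]]; have [_ leW] := price_concat_le cW pWs.
move=> inf; apply: le_trans leW _; rewrite /ticket_price.
elim: Ws T pWs pT inf {cW} => [|W1 Ws IH] [|H T] //= /andP[pW1 pWs] /andP[pH pT] /andP[inf infs].
by rewrite !big_cons lerD ?IH // price_le ?path_len_infix.
Qed.

Lemma shortest_path_cheapest_standard_ticket u v W :
  shortest_path u v W -> cheapest_standard_ticket G p u v [:: W].
Proof.
move=> [pW leW]; split=> [|W' T' /leW leW' ->]; first by exists W.
by rewrite /ticket_price !big_seq1 price_le.
Qed.

Lemma shortest_path_cheapest_ticket u v W :
  shortest_path u v W -> cheapest_ticket G p u v [:: W].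
Proof.
move=> [pW leW]; split=> [|W' T' /leW leW' /price_ticket_le].
  have pathW : is_path G W by case/and3P: pW.
  exists W => //; split; first by rewrite /= pathW.
  by exists [:: W]; split; [rewrite /= pathW | constructor | rewrite /= infix_refl].
by apply: le_trans; rewrite /ticket_price big_seq1 price_le.
Qed.

End Tariff.
End Paths.

(** * The Bellman-Ford algorithm *)

(** [succ l u] is 0 if no path from [u] to the destination is known, and
    otherwise one plus the node after [u] on such a path, of length [dist l u];
    one plus the number of nodes marks the destination itself. *)
Record labels (K : realFieldType) := Labels { dist : nat -> K; succ : nat -> nat }.

Section BellmanFord.
Variables (K : realFieldType) (n : nat) (G : ptn 'I_n K) (d : 'I_n).
Local Open Scope ring_scope.

Variable A : nat -> nat -> K.
Hypothesis AE : forall u v : 'I_n, A u v = if adj G u v then len G u v else 0.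

Lemma A_gt0 (u v : 'I_n) : (0 < A u v) = adj G u v.
Proof. by rewrite AE; case: ifP => [/len_gt0//|]; rewrite ltxx. Qed.

(** A label 0 of [succ] stands for an infinite distance. *)
Definition improves (l : labels K) (u v : nat) : bool :=
  (succ l u == 0%N) || (A u v + dist l v < dist l u).

Definition relax (u v : nat) (l : labels K) : labels K :=
  if [&& (0 < succ l v)%N, 0 < A u v & improves l u v] then
    Labels (upd (dist l) u (A u v + dist l v)) (upd (succ l) u v.+1)
  else l.

Definition relax_row (u : nat) (l : labels K) : labels K := iteri n (relax u) l.
Definition relax_all (l : labels K) : labels K := iteri n relax_row l.
Definition init_labels : labels K := Labels (fun=> 0) (upd (fun=> 0%N) d n.+1).
Definition rounds (r : nat) : labels K := iteri r (fun=> relax_all) init_labels.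

(** The bound on the number of nodes serves to bound the sizes of the numbers
    that occur. The recorded successor of a node may have been improved since
    it was recorded, whence an inequality between their distances. *)
Record sound (k : nat) (l : labels K) : Prop := Sound {
  sound_path : forall u : 'I_n, (0 < succ l u)%N ->
    exists W, [/\ path_from_to G u d W, path_len G W = dist l u & (size W <= k.+1)%N];
  sound_dest : succ l d = n.+1 /\ dist l d = 0;
  sound_succ : forall u : 'I_n, u != d -> (0 < succ l u)%N ->
    exists w : 'I_n, [/\ succ l u = w.+1, adj G u w, (0 < succ l w)%N
                       & len G u w + dist l w <= dist l u]
}.

Lemma sound_dist_ge0 k l (u : 'I_n) : sound k l -> (0 < succ l u)%N -> 0 <= dist l u.
Proof.
by case=> sp _ _ /sp[W [/and3P[pW _ _] <- _]]; apply: path_len_ge0.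
Qed.

Lemma sound_leq k k' l : (k <= k')%N -> sound k l -> sound k' l.
Proof.
move=> kk' [sp sd ss]; split=> // u /sp[W [pW lW kW]].
by exists W; split=> //; apply: leq_trans kW _.
Qed.

Lemma sound_init : sound 0 init_labels.
Proof.
split=> [u|/=|u] /=; rewrite /upd ?eqxx //.
  case: eqP => // /ord_inj-> _; exists [:: d].
  by rewrite path_len1; split=> //; apply/and3P.
by move=> ud; rewrite val_eqE (negPf ud).
Qed.

(** The new distance computed by [relax] is the length of a path even if it is
    then discarded; this bounds the size of the number that is compared. *)
Lemma relax_path k l (u v : 'I_n) : sound k l -> adj G u v -> (0 < succ l v)%N ->
  exists W, [/\ path_from_to G u d W, path_len G W = A u v + dist l v
              & (size W <= k.+2)%N].
Proof.
move=> [sp _ _] uv /sp[[|w W] [/and3P[// pW /= /eqP wv lW] len_W szW]]; subst w.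
exists (u :: v :: W); split=> //; last by rewrite path_len_cons AE uv len_W.
by apply/and3P; split; rewrite //= uv.
Qed.

(** The label of the destination is never replaced, as all edges have positive
    lengths and its distance is already 0. *)
Lemma sound_relax k l (u v : 'I_n) : sound k l -> sound k.+1 (relax u v l).
Proof.
move=> sl; have sl1 := sound_leq (leqnSn k) sl.
rewrite /relax; case: ifP => // /and3P[v0]; rewrite A_gt0 => uv imp.
have [sp [sd dd] ss] := sl1.
have ud : (u : nat) != d.
  apply/eqP => /ord_inj ud; move: imp; rewrite /improves ud sd dd /= => lt0.
  have := sound_dist_ge0 sl v0; have: 0 < A d v by rewrite -ud A_gt0.
  by move=> Adv dv; move: lt0; rewrite ltNge ltW // ltr_wpDr.
have uv' : (v : nat) == u = false.
  by apply/eqP => /ord_inj vu; move: uv; rewrite vu adj_irr.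
split=> /=.
- move=> w; rewrite /upd; case: eqP => [/ord_inj-> _|_ /sp//].
  exact: relax_path sl uv v0.
- by rewrite /upd eq_sym (negPf ud).
- move=> w wd; rewrite /upd; case: (eqVneq (w : nat) u) => [/ord_inj-> _|wu w0].
    by exists v; rewrite uv' AE uv.
  have [x [xw wx x0 lex]] := ss w wd w0; exists x; split=> //; case: eqP => // xu.
  move: imp; rewrite /improves -xu; case: eqP => [x00|_ /= lt]; first by rewrite x00 in x0.
  by apply: le_trans lex; rewrite lerD2l ltW.
Qed.

Lemma sound_iteri (f : nat -> labels K -> labels K) (m k j : nat) (l : labels K) :
  (forall (i : 'I_n) k' l', sound k' l' -> sound (k' + m) (f i l')) ->
  (j <= n)%N -> sound k l -> sound (k + j * m) (iteri j f l).
Proof.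
move=> sf; elim: j => [|j IHj] jn sl; first by rewrite addn0.
rewrite mulSnr addnA; apply: (sf (Ordinal jn)); exact: IHj (ltnW jn) sl.
Qed.

Definition labels_at (r u v : nat) : labels K :=
  iteri v (relax u) (iteri u relax_row (rounds r)).

Lemma sound_relax_row k l (u : 'I_n) : sound k l -> sound (k + n) (relax_row u l).
Proof.
move=> sl; have := @sound_iteri (relax u) 1 k n l _ (leqnn n) sl; rewrite muln1; apply.
by move=> v k' l'; rewrite addn1; apply: sound_relax.
Qed.

Lemma sound_relax_all k l : sound k l -> sound (k + n * n) (relax_all l).
Proof. by apply: sound_iteri => // u k' l'; apply: sound_relax_row. Qed.

Lemma sound_rounds r : sound (r * (n * n)) (rounds r).
Proof.
rewrite /rounds; elim: r => [|r IHr]; first exact: sound_init.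
by rewrite mulSnr; apply: sound_relax_all.
Qed.

Lemma sound_labels_at r (u v : 'I_n) : sound (r * (n * n) + u * n + v) (labels_at r u v).
Proof.
rewrite -[X in (_ + X)%N]muln1; apply: sound_iteri; last 1 first.
- by apply: sound_iteri (sound_rounds r) => [w k l|]; [exact: sound_relax_row | exact: ltnW].
- by move=> w k l; rewrite addn1; apply: sound_relax.
- exact: ltnW.
Qed.

Definition improved (l l' : labels K) : Prop :=
  forall u, (0 < succ l u)%N -> (0 < succ l' u)%N /\ dist l' u <= dist l u.

Lemma improved_refl l : improved l l.
Proof. by []. Qed.

Lemma improved_trans l2 l1 l3 : improved l1 l2 -> improved l2 l3 -> improved l1 l3.
Proof.
move=> i12 i23 u /i12[/i23[u3 l32] l21]; split=> //; exact: le_trans l32 l21.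
Qed.

Lemma improved_relax u v l : improved l (relax u v l).
Proof.
move=> w w0; rewrite /relax; case: ifP => // /and3P[v0 _ imp] /=.
rewrite /upd; case: eqP => // wu; split=> //.
by move: imp; rewrite /improves -wu => /orP[/eqP w00|/ltW//]; rewrite w00 in w0.
Qed.

Lemma improved_iteri (f : nat -> labels K -> labels K) (j : nat) l :
  (forall i l', improved l' (f i l')) -> improved l (iteri j f l).
Proof.
move=> imp; elim: j => [|j IHj] //=; exact: improved_trans IHj (imp _ _).
Qed.

(** Each round [i] of a loop is carried out on some labels that are no worse than
    the initial ones, and later rounds keep what it achieves. *)
Lemma iteri_through (f : nat -> labels K -> labels K) (i j : nat) l :
  (forall i l', improved l' (f i l')) -> (i < j)%N ->
  exists2 l', improved l l' & improved (f i l') (iteri j f l).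
Proof.
move=> imp; elim: j => // j IHj; rewrite ltnS leq_eqVlt => /predU1P[->|/IHj[l' ll' l'f]] /=.
  by exists (iteri j f l); [apply: improved_iteri | apply: improved_refl].
by exists l' => //; apply: improved_trans l'f (imp _ _).
Qed.

Lemma improved_relax_row u l : improved l (relax_row u l).
Proof. by apply: improved_iteri => v l'; apply: improved_relax. Qed.

Lemma improved_relax_all l : improved l (relax_all l).
Proof. by apply: improved_iteri => u l'; apply: improved_relax_row. Qed.

Lemma relax_edge (u v : 'I_n) l : adj G u v -> (0 < succ l v)%N ->
  (0 < succ (relax u v l) u)%N /\ dist (relax u v l) u <= len G u v + dist l v.
Proof.
move=> uv v0; rewrite /relax v0 A_gt0 uv /improves AE uv /=.
case: ifP => [_|/norP[]]; first by rewrite /= /upd eqxx.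
by rewrite -lt0n -leNgt.
Qed.

Lemma relax_all_edge (u v : 'I_n) l : adj G u v -> (0 < succ l v)%N ->
  (0 < succ (relax_all l) u)%N /\ dist (relax_all l) u <= len G u v + dist l v.
Proof.
move=> uv v0.
have [l1 ll1 l1l] := iteri_through l improved_relax_row (ltn_ord u).
have [l2 l12 l2l] := iteri_through l1 (improved_relax u) (ltn_ord v).
have [v2 le2] := improved_trans ll1 l12 v0.
have [u2 le] := relax_edge uv v2.
have [u3 le3] := improved_trans l2l l1l u2; split=> //.
by apply: le_trans le3 (le_trans le _); rewrite lerD2l.
Qed.

(** Each round accounts for one more edge, since a path from the second node of
    [W] that is no longer than the rest of [W] is already known when the first
    edge of [W] is relaxed. *)
Lemma rounds_complete r (u : 'I_n) W : path_from_to G u d W -> (size W <= r.+1)%N ->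
  (0 < succ (rounds r) u)%N /\ dist (rounds r) u <= path_len G W.
Proof.
elim: r u W => [|r IHr] u [|w W] // /and3P[pW /= /eqP wu lW] szW; subst w.
  case: W pW lW szW => //= _ /eqP->; rewrite /upd eqxx path_len1; split=> //.
have [|W0] := ltnP (size W) r.+1.
  move=> szW'; have [|u0 le] := IHr u (u :: W) _ szW'; first by apply/and3P; split=> /=.
  have [u1 le1] := improved_relax_all u0; split=> //; exact: le_trans le1 le.
case: W pW lW szW W0 => // v W /= /andP[uv pW] lW szW _.
have [|v0 le] := IHr v (v :: W) _ szW; first by apply/and3P; split=> /=.
have [u1 le1] := relax_all_edge uv v0; split=> //.
by rewrite path_len_cons (le_trans le1) // lerD2l.
Qed.

(** As many rounds as there are nodes suffice, because closed parts of a path can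
    be left out. *)
Lemma rounds_optimal (u : 'I_n) W : path_from_to G u d W ->
  (0 < succ (rounds n) u)%N /\ dist (rounds n) u <= path_len G W.
Proof.
move=> /simple_path_leq[W' [pW' uW' leW']].
have [|u0 le] := rounds_complete pW' (_ : (size W' <= n.+1)%N).
  by rewrite (leq_trans (uniq_leq_size uW' (s2 := enum 'I_n) _)) ?size_enum_ord //
     => x _; rewrite mem_enum.
by split=> //; apply: le_trans le leW'.
Qed.

End BellmanFord.

(** * The program *)

Definition reg (k : nat) : iexp := ILoad (IConst k).

(** The successors are stored behind the cells 2, ..., n + 1 to which the path is
    written in the end, so that these can be overwritten while the successors are
    followed.  The register [k] holds the number of stations. *)
Definition succ_addr (k : nat) (u : iexp) : iexp := IAdd (IAdd (reg k) (IConst 6)) u.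

(** The input consists of three prices followed by the matrix of the lengths. *)
Definition weight_addr (u v : iexp) : iexp :=
  IAdd (IConst 3) (IAdd (IMul u (reg 0)) v).

Definition dist_addr (u : iexp) : iexp :=
  IAdd (IConst 3) (IAdd (IMul (reg 0) (reg 0)) u).

(** The counters [u] and [v] are in registers 4 and 5; the new distance is kept in
    the number cell 0, where the input has the base price. *)
Definition relax_cmd : cmd :=
  If (BAnd (BLtI (IConst 0) (ILoad (succ_addr 0 (reg 5))))
           (BLtN NZero (NLoad (weight_addr (reg 4) (reg 5)))))
    (Seq (NStore (IConst 0) (NAdd (NLoad (weight_addr (reg 4) (reg 5)))
                                  (NLoad (dist_addr (reg 5)))))
      (If (BNot (BAnd (BLtI (IConst 0) (ILoad (succ_addr 0 (reg 4))))
                      (BNot (BLtN (NLoad (IConst 0)) (NLoad (dist_addr (reg 4)))))))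
        (Seq (NStore (dist_addr (reg 4)) (NLoad (IConst 0)))
             (IStore (succ_addr 0 (reg 4)) (IAdd (reg 5) (IConst 1))))
        Skip))
    Skip.

Definition for_cmd (x : nat) (body : cmd) : cmd :=
  Seq (IStore (IConst x) (IConst 0))
    (While (BLtI (reg x) (reg 0))
       (Seq body (IStore (IConst x) (IAdd (reg x) (IConst 1))))).

Definition bellman_ford_cmd : cmd := for_cmd 3 (for_cmd 4 (for_cmd 5 relax_cmd)).

(** The nodes of the path are written to the output cells as they are found.
    Register 0 counts them, so that the last one found is in the cell whose
    address is one more than this count. *)
Definition current_node : iexp := ILoad (IAdd (reg 0) (IConst 1)).

Definition trace_cmd : cmd :=
  While (BLtI (ILoad (succ_addr 1 current_node)) (IAdd (reg 1) (IConst 1)))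
    (Seq (IStore (IAdd (reg 0) (IConst 2))
                 (ISub (ILoad (succ_addr 1 current_node)) (IConst 1)))
         (IStore (IConst 0) (IAdd (reg 0) (IConst 1)))).

(** Register 0 has to count the nodes of the path, so that the number of stations
    moves to register 1, and the origin to the first cell of the path.  At the end,
    the output is one path, preceded by its number of nodes. *)
Definition shortest_path_cmd : cmd :=
  Seq (IStore (succ_addr 0 (reg 2)) (IAdd (reg 0) (IConst 1)))
  (Seq bellman_ford_cmd
  (Seq (IStore (IConst 2) (reg 1))
  (Seq (IStore (IConst 1) (reg 0))
  (Seq (IStore (IConst 0) (IConst 1))
  (Seq trace_cmd
  (Seq (IStore (IConst 1) (reg 0))
       (IStore (IConst 0) (IConst 1)))))))).

Section Correctness.
Variables (K : realFieldType) (sz : K -> nat) (X n : nat).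
Variables (G : ptn 'I_n K) (o d : 'I_n) (A : nat -> nat -> K).
Hypothesis AE : forall u v : 'I_n, A u v = (if adj G u v then len G u v else 0)%R.
Hypothesis nX : n < X.

Lemma small_istore (s : state K) a i : small sz X s -> i <= X ->
  small sz X (State (upd (imem s) a i) (nmem s)).
Proof. by move=> [sI sN] iX; split=> // b /=; rewrite /upd; case: ifP. Qed.

Lemma small_nstore (s : state K) a (q : K) : small sz X s -> sz q <= X ->
  small sz X (State (imem s) (upd (nmem s) a q)).
Proof. by move=> [sI sN] qX; split=> // b /=; rewrite /upd; case: ifP. Qed.

Record represents (l : labels K) (s : state K) : Prop := Represents {
  rep_small : small sz X s;
  rep_n : imem s 0 = n;
  rep_o : imem s 1 = o;
  rep_d : imem s 2 = d;
  rep_succ : forall u, u < n -> imem s (n + 6 + u) = succ l u;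
  rep_weight : forall u v, u < n -> v < n -> nmem s (3 + (u * n + v)) = A u v;
  rep_dist : forall u, u < n -> nmem s (3 + (n * n + u)) = dist l u
}.

(** The registers 3, 4 and 5 are free for the loop counters. *)
Lemma represents_counter l s x i : 2 < x < 6 -> i <= X ->
  represents l s -> represents l (State (upd (imem s) x i) (nmem s)).
Proof.
move=> x36 iX [sS n0 o1 d2 su we di]; split=> //=; first exact: small_istore.
1-3: by rewrite /upd; case: eqP => //; lia.
by move=> u un; rewrite /upd; case: eqP => [|_]; [lia | exact: su].
Qed.

Lemma runs_for x body (inv : nat -> state K -> Prop) s : 2 < x < 6 ->
  (forall i s', inv i s' -> small sz X s' /\ imem s' 0 = n) ->
  (forall i s' j, j <= X -> inv i s' -> inv i (State (upd (imem s') x j) (nmem s'))) ->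
  (forall i s', i < n -> inv i s' -> imem s' x = i ->
     runs sz X body s' (fun s2 => inv i.+1 s2 /\ imem s2 x = i)) ->
  inv 0 s -> runs sz X (for_cmd x body) s (inv n).
Proof.
move=> x36 invS inv_upd body_inv inv0; apply: runs_seq.
apply: runs_istore => /=; first by case: (invS _ _ inv0).
apply: (runs_while (inv := fun i s' => [/\ inv i s', imem s' x = i & i <= n]) (N := n)).
- exact: ltnW.
- by move=> i s' [/invS[sS _] _ _].
- move=> i s' [inv_i xi _] /=; rewrite xi (invS _ _ inv_i).2 => ltin; split=> //.
  apply: runs_seq; apply: runs_weaken (body_inv _ _ ltin inv_i xi) => s2 [inv_i1 xi2].
  apply: runs_istore; first by case: (invS _ _ inv_i1).
  rewrite /= xi2 addn1; split=> //; last by rewrite /upd eqxx.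
  by apply: inv_upd => //; lia.
- move=> i s' [inv_i xi lein] /=; rewrite xi (invS _ _ inv_i).2 -leqNgt => leni.
  by have <- : i = n by lia.
- by split=> //=; [exact: inv_upd | rewrite /upd eqxx].
Qed.

(** Each step from [u] to [v] has length at most [dist l u - dist l v], which is
    the reason why the path is no longer than [dist l o].  As edge lengths are
    positive, [dist l] decreases, no node is repeated, and the path is complete
    after fewer than [n] steps. *)
Lemma runs_trace k l s : sound G d k l -> small sz X s -> 0 < succ l o ->
  imem s 0 = 1 -> imem s 1 = n -> imem s 2 = o ->
  (forall u, u < n -> imem s (n + 6 + u) = succ l u) ->
  runs sz X trace_cmd s (fun s' => exists H : seq 'I_n,
    [/\ small sz X s', path_from_to G o d H, (path_len G H <= dist l o)%R,
        imem s' 0 = size H &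
        forall i, i < size H -> imem s' (2 + i) = nth 0 (map val H) i]).
Proof.
move=> snd sS o0 s0 s1 s2 ss.
pose closer : rel 'I_n := fun u v => adj G u v && (dist l v < dist l u)%R.
pose inv i s' := exists W : seq 'I_n,
  [/\ [/\ size W = i, path closer o W,
         (path_len G (o :: W) + dist l (last o W) <= dist l o)%R & 0 < succ l (last o W)],
      small sz X s', imem s' 0 = i.+1, imem s' 1 = n &
      (forall j, j <= i -> imem s' (2 + j) = nth 0 (map val (o :: W)) j) /\
      forall u, u < n -> imem s' (n + 6 + u) = succ l u].
have cur i (s' : state K) W : size W = i -> (forall j, j <= i -> imem s' (2 + j) =
    nth 0 (map val (o :: W)) j) -> imem s' (i.+1 + 1) = last o W.
  move=> szW out; rewrite addn1 -[i.+2]/(2 + i) out //.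
  by rewrite (nth_map o) /= ?szW // -szW nth_last.
have in_range i W : size W = i -> path closer o W -> i < n.
  move=> <- pW; have uW : uniq (o :: W).
    apply: (@sorted_uniq _ (fun u v : 'I_n => (dist l v < dist l u)%R)).
    - by move=> y x z yx zy; apply: lt_trans yx.
    - by move=> x; apply: ltxx.
    - by apply: sub_path pW => x y /andP[].
  have := uniq_leq_size uW (s2 := enum 'I_n).
  by rewrite size_enum_ord; apply => x _; rewrite mem_enum.
apply: (runs_while (inv := inv) (N := n)).
- exact: ltnW.
- by move=> i s' [W [_ sS' _ _ _]].
- move=> i s' [W [[szW pW lW last0] sS' c0 n1 [out su]]] /=.
  rewrite c0 n1 (cur _ _ _ szW out) su // addn1 => lt.
  split; first exact: in_range szW pW.
  have ud : last o W != d.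
    by apply: contraTneq lt => ->; rewrite (sound_dest snd).1 ltnn.
  have [w [sw uw w0 lew]] := sound_succ snd ud last0.
  apply: runs_seq; apply: runs_istore => //=.
  rewrite c0 n1 (cur _ _ _ szW out) su // sw subn1 /=.
  have wX : w <= X by rewrite ltnW // (ltn_trans (ltn_ord w)).
  have in_i := in_range _ _ szW pW.
  apply: runs_istore => /=; first exact: small_istore.
  exists (rcons W w); split.
  - rewrite size_rcons szW last_rcons rcons_path pW -rcons_cons path_len_rcons; split=> //.
      rewrite /closer uw (lt_le_trans _ lew) //= ltrDr len_gt0 //.
    by apply: le_trans lW; rewrite -addrA lerD2l.
  - apply: (small_istore _ (small_istore _ sS' wX)).
    by rewrite /= /upd /= c0; lia.
  - by rewrite /= /upd /= c0 addn1.
  - by rewrite /= /upd /= n1 addn2; case: eqP => //; lia.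
  have mapE : map val (o :: rcons W w) = rcons (map val (o :: W)) (val w).
    by rewrite -rcons_cons map_rcons.
  split=> [j jle|u un]; rewrite ?mapE [imem _ _]/= /upd.
    rewrite (_ : 2 + j == 0 = false) // nth_rcons size_map [size _]/= szW.
    case: eqP => [ji|ji]; first by rewrite (_ : j = i.+1) ?ltnn ?eqxx //; lia.
    have jlei : j <= i by lia.
    by rewrite out // ltnS jlei.
  by do 2![case: eqP => [|_]; first by lia]; apply: su.
- move=> i s' [W [[szW pW lW last0] sS' c0 n1 [out su]]] /=.
  rewrite c0 n1 (cur _ _ _ szW out) su // addn1 -leqNgt => ge.
  have ud : last o W = d.
    apply/eqP; apply: contraLR ge => ud.
    by have [w [-> _ _ _]] := sound_succ snd ud last0; rewrite -ltnNge ltnS.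
  exists (o :: W); split=> //=; last 2 first.
  - by rewrite szW.
  - by move=> j; rewrite szW ltnS => /out.
  - apply/and3P; split=> //=; last by rewrite ud.
    by apply: sub_path pW => x y /andP[].
  - by move: lW; rewrite ud (sound_dest snd).2 addr0.
- exists [::]; split=> //=.
  + by rewrite path_len1 add0r.
  + by split=> // j; rewrite leqn0 => /eqP->; rewrite addn0 s2.
Qed.

Hypothesis sz0 : sz 0%R <= X.
Hypothesis sz_path : forall W, is_path G W -> size W <= (n * (n * n)).+1 ->
  sz (path_len G W) <= X.

Lemma runs_relax l s u v : represents l s -> u < n -> v < n ->
  imem s 4 = u -> imem s 5 = v ->
  (0 < succ l v -> (0 < A u v)%R -> sz (A u v + dist l v)%R <= X) ->
  runs sz X relax_cmd s (fun s' => represents (relax A u v l) s' /\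
    forall x, 2 < x < 6 -> imem s' x = imem s x).
Proof.
move=> rep un vn su sv szX; have [sS n0 o1 d2 rs rw rd] := rep.
have sN := sS.2.
apply: runs_if => //=.
rewrite n0 su sv rs // rw //.
case: (boolP (0 < succ l v)) => [v0|v0] /=; last first.
  by apply: runs_skip; rewrite /relax (negPf v0).
case: (boolP (0 < A u v)%R) => [uv|uv] /=; last first.
  by apply: runs_skip; rewrite /relax v0 (negPf uv).
have tX := szX v0 uv.
apply: runs_seq; apply: runs_nstore => /=; [by [] | by do !split=> //; rewrite n0 su sv rw // rd | ].
rewrite n0 su sv rw // rd //.
set t := (A u v + dist l v)%R.
have sS1 := small_nstore 0 sS tX; rewrite -/t in sS1.
apply: runs_if => /=; [by [] | by do !split=> //; exact: sN | ].
rewrite n0 su rs // /upd [_ == 0]/= rd //.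
have -> : (~~ ((0 < succ l u) && ~~ (t < dist l u)%R)) = improves A l u v.
  by rewrite /improves negb_and negbK -eqn0Ngt.
case: (boolP (improves A l u v)) => imp; last first.
  by apply: runs_skip; rewrite /relax v0 uv (negPf imp); split=> //; split.
rewrite /relax v0 uv imp /=.
apply: runs_seq; apply: runs_nstore => /=; [by [] | by split; rewrite ?/upd | ].
apply: runs_istore => /=; first exact: (small_nstore _ sS1 tX).
rewrite n0 su sv addn1; split; last first.
  by move=> x x36 /=; rewrite /upd; case: eqP => //; lia.
split=> //=.
- by apply: (small_istore _ (small_nstore _ sS1 tX)); lia.
- by rewrite /upd; case: eqP => //; lia.
- by rewrite /upd; case: eqP => //; lia.
- by rewrite /upd; case: eqP => //; lia.
- by move=> w wn; rewrite /upd eqn_add2l; case: eqP => // _; apply: rs.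
- move=> a b an bn; rewrite /upd; case: eqP => [|_]; first by nia.
  exact: rw.
- by move=> w wn; rewrite /upd !eqn_add2l; case: eqP => // _; apply: rd.
Qed.

(** In the three invariants, [labels_at r u v] is the state of the labels before
    the pair [(u, v)] is relaxed in round [r]; the end of an inner loop is the
    next value of the outer counter by definition: [labels_at r u n] is
    [labels_at r u.+1 0]. *)
Lemma runs_bellman_ford s : represents (init_labels K d) s ->
  runs sz X bellman_ford_cmd s (represents (rounds d A n)).
Proof.
move=> rep0; pose L := labels_at d A.
have repS l s' : represents l s' -> small sz X s' /\ imem s' 0 = n by case.
apply: (runs_for (inv := fun r => represents (rounds d A r))) => //.
- by move=> r s'; apply: repS.
- by move=> r s' j jX; apply: represents_counter.
move=> r s1 rn rep1 r1.
apply: (runs_weaken (Q := fun s' => represents (L r n 0) s' /\ imem s' 3 = r)) => //.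
apply: (runs_for (inv := fun u s' => represents (L r u 0) s' /\ imem s' 3 = r)) => //.
- by move=> u s' [/repS].
- by move=> u s' j jX [rep' r']; split=> //; apply: represents_counter.
move=> u s2 un [rep2 r2] u2.
apply: (runs_weaken
  (Q := fun s' => [/\ represents (L r u n) s', imem s' 3 = r & imem s' 4 = u])).
  by move=> s' [].
apply: (runs_for
  (inv := fun v s' => [/\ represents (L r u v) s', imem s' 3 = r & imem s' 4 = u])) => //.
- by move=> v s' [/repS].
- by move=> v s' j jX [rep' r' u']; split=> //; apply: represents_counter.
move=> v s3 vn [rep3 r3 u3] v3.
apply: runs_weaken (runs_relax rep3 un vn u3 v3 _) => [s' [rep' keep]|v0].
  by rewrite !keep.
have /= := A_gt0 AE (Ordinal un) (Ordinal vn) => -> uv.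
have snd := sound_labels_at d AE r (Ordinal un) (Ordinal vn).
have [W [pW <- szW]] := relax_path AE snd uv v0.
apply: sz_path; first by case/and3P: pW.
by apply: leq_trans szW _ => /=; nia.
Qed.

Lemma runs_shortest_path (s : state K) : small sz X s ->
  imem s 0 = n -> imem s 1 = o -> imem s 2 = d ->
  (forall a, 2 < a -> imem s a = 0) ->
  (forall u v, u < n -> v < n -> nmem s (3 + (u * n + v)) = A u v) ->
  (forall u, u < n -> nmem s (3 + (n * n + u)) = 0%R) ->
  runs sz X shortest_path_cmd s (fun s' => exists H : seq 'I_n,
    shortest_path G o d H /\ outputs s' (encode_ticket [:: H])).
Proof.
move=> sS s0 s1 s2 si sw sd.
have on := ltn_ord o; have dn := ltn_ord d.
apply: runs_seq; apply: runs_istore => //=; rewrite s0 s2 addn1.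
apply: runs_seq.
apply: (runs_weaken (Q := represents (rounds d A n))); last first.
  apply: runs_bellman_ford; split=> //=.
  - exact: small_istore.
  - by rewrite /upd; case: eqP => //; lia.
  - by rewrite /upd; case: eqP => //; lia.
  - by rewrite /upd; case: eqP => //; lia.
  - by move=> u un; rewrite /upd eqn_add2l; case: eqP => // _; apply: si; lia.
move=> {sS s0 s1 s2 si sw sd} s [sS s0 s1 s2 ss _ _].
have [p op dp] := connectP (adj_connected G o d).
have pathp : path_from_to G o d (o :: p) by apply/and3P; rewrite /= -dp.
have [o0 _] := rounds_optimal AE pathp.
have oX : o <= X by apply: ltnW; apply: ltn_trans nX.
have X1 : 1 <= X by apply: leq_trans nX.
apply: runs_seq; apply: runs_istore => //=; rewrite s1.
have sS1 := small_istore 2 sS oX.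
apply: runs_seq; apply: runs_istore => //=; rewrite /upd /= s0.
have sS2 := small_istore 1 sS1 (ltnW nX).
apply: runs_seq; apply: runs_istore => //=; rewrite /upd /=.
have sS3 := small_istore 0 sS2 X1.
apply: runs_seq.
set s3 := State _ _.
have trace := @runs_trace _ _ s3 (sound_rounds d AE n) sS3 o0.
apply: runs_weaken (trace _ _ _ _) => //=; last first.
  by move=> u un; do 3![case: eqP => [|_]; first by lia]; apply: ss.
move=> s' [H [sS' pH lH h0 out]].
apply: runs_seq; apply: runs_istore => //=; rewrite h0.
have szH : size H <= X.
  by rewrite -h0; apply: sS'.1.
apply: runs_istore => /=; first exact: small_istore.
exists H; split.
  split=> // W' /(rounds_optimal AE)[_]; exact: le_trans.
move=> [|[|i]] //=; rewrite cats0 size_map !ltnS => iH.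
by rewrite -out.
Qed.

End Correctness.

(** * Sizes of sums *)

(** Unlike the bit size, this measure can only be multiplied when numbers are
    added, so that the bounds on long sums do not grow with the
    nesting of the additions. *)
Definition rat_weight (q : rat) : nat := `|numq q| + `|denq q|.

(** A common denominator of two fractions need not be the least one. *)
Lemma rat_weightD (a b : rat) : rat_weight (a + b)%R <= rat_weight a * rat_weight b.
Proof.
have da0 : ((denq a)%:~R != 0 :> rat)%R by rewrite intr_eq0 denq_neq0.
have db0 : ((denq b)%:~R != 0 :> rat)%R by rewrite intr_eq0 denq_neq0.
pose N := (numq a * denq b + numq b * denq a)%R; pose D := (denq a * denq b)%R.
have ab : (a + b = N%:~R / D%:~R)%R.
  by rewrite -{1}[a]divq_num_den -{1}[b]divq_num_den addf_div // rmorphD !rmorphM.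
have D0 : D != 0%R by rewrite mulf_neq0 ?denq_neq0.
have le : rat_weight (a + b)%R <= `|N| + `|D|.
  rewrite ab /rat_weight; move: D0; case: divqP => [|k x k0 _]; first by rewrite eqxx.
  rewrite !abszM; have : 0 < `|k| by rewrite absz_gt0.
  by nia.
apply: leq_trans le _; rewrite /rat_weight {ab}.
rewrite /N /D; nia.
Qed.

Lemma rat_weight_leq (q : rat) : rat_weight q <= 2 ^ rat_bit_size q.
Proof.
have bl m : m < 2 ^ bit_length m by apply: trunc_log_ltn.
have bl1 m : 2 <= 2 ^ bit_length m by rewrite -{1}(expn1 2) leq_exp2l.
rewrite /rat_weight /rat_bit_size expnD.
have := bl `|numq q|; have := bl `|denq q|; have := bl1 `|numq q|; have := bl1 `|denq q|.
by nia.
Qed.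

Lemma rat_bit_size_leq (q : rat) k : rat_weight q <= 2 ^ k -> rat_bit_size q <= 2 * k.+1.
Proof.
move=> qk; rewrite /rat_bit_size mul2n -addnn.
have bl m : m <= rat_weight q -> bit_length m <= k.+1.
  by move=> mq; rewrite ltnS -(trunc_expnK k (ltnSn 1)) leq_trunc_log // (leq_trans mq).
by rewrite leq_add // bl // ?leq_addl ?leq_addr.
Qed.

Lemma rat_bit_size_sum (xs : seq rat) B : {in xs, forall x, rat_bit_size x <= B} ->
  rat_bit_size (\sum_(x <- xs) x)%R <= 2 * (size xs * B).+1.
Proof.
move=> xsB; apply: rat_bit_size_leq; elim: xs xsB => [|x xs IH] xsB.
  by rewrite big_nil.
rewrite big_cons mulSn expnD (leq_trans (rat_weightD _ _)) // leq_mul //.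
  by rewrite (leq_trans (rat_weight_leq _)) // leq_exp2l // xsB ?mem_head.
by apply: IH => y yxs; rewrite xsB // inE yxs orbT.
Qed.

(** * Polynomial time *)

Section PolynomialTime.
Variables (K : realFieldType) (sz : K -> nat).
(** This is the only property of the size function that the running time depends
    on. *)
Hypothesis sz_sum : forall (xs : seq K) B, {in xs, forall x, sz x <= B} ->
  sz (\sum_(x <- xs) x)%R <= 2 * (size xs * B).+1.

Lemma sz_path_leq n (G : ptn 'I_n K) B W k :
  (forall u v, adj G u v -> sz (len G u v) <= B) -> is_path G W -> size W <= k.+1 ->
  sz (path_len G W) <= 2 * (k * B).+1.
Proof.
move=> lenB pW szW; rewrite /path_len.
rewrite -(big_map (fun e => len G e.1 e.2) xpredT id).
apply: leq_trans (sz_sum (B := B) _) _.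
  by move=> _ /mapP[e /(path_edges pW)/lenB leB ->].
by rewrite size_map size_zip size_behead leq_mul2l ltnS leq_mul //; lia.
Qed.

Lemma nth_allpairs (T1 T2 T : Type) (f : T1 -> T2 -> T) x1 x2 x s t i j :
  i < size s -> j < size t ->
  nth x [seq f a b | a <- s, b <- t] (i * size t + j) = f (nth x1 s i) (nth x2 t j).
Proof.
elim: s i => // a s IHs [|i] /= si tj; rewrite nth_cat size_map.
  by rewrite tj (nth_map x2).
by rewrite mulSn -addnA ltnNge leq_addr addKn IHs.
Qed.

Section Instance.
Variable I : instance K.
Local Notation n := (nstations I).
Local Notation G := (network I).
Local Notation L := (instance_size sz I).
Let s0 := input_state I.

Let weight (u v : nat) : K := nmem s0 (3 + (u * n + v)).

Lemma weightE (u v : 'I_n) :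
  weight u v = (if adj G u v then len G u v else 0)%R.
Proof.
have := @nth_allpairs _ _ K (fun u v => if adj G u v then len G u v else 0%R)
  u v 0%R (enum 'I_n) (enum 'I_n) u v.
by rewrite !size_enum_ord !nth_ord_enum /weight => <-.
Qed.

Lemma input_dist0 a : nmem s0 (3 + (n * n + a)) = 0%R.
Proof.
by rewrite /= nth_default // size_allpairs size_enum_ord leq_addr.
Qed.

Lemma nstations_leq : n <= L.
Proof. by rewrite /instance_size -!addnA leq_addr. Qed.

Lemma size_len_leq u v : adj G u v -> sz (len G u v) <= L.
Proof.
move=> uv; rewrite /instance_size (bigD1 u) //= (bigD1 v) //=; lia.
Qed.

Lemma input_small X : 2 <= X -> L <= X -> small sz X s0.
Proof.
move=> X2 LX; have nX : n <= X := leq_trans nstations_leq LX.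
have sz0 : sz 0%R <= X.
  by have := @sz_sum [::] 0; rewrite big_nil => /(_ _)/leq_trans; apply.
split=> a /=.
  case: a => [|[|[|a]]] //=; try by rewrite (leq_trans _ nX) // ltnW.
  by rewrite nth_nil.
have tariffL : [/\ sz (base_price (tariff I)) <= L, sz (price_per_unit (tariff I)) <= L
                 & sz (flat_price (tariff I)) <= L].
  by rewrite /instance_size; split; lia.
have [t1 t2 t3] := tariffL.
case: a => [|[|[|a]]] /=; try exact: leq_trans LX.
case: (ltnP a (size [seq (if adj G u v then len G u v else 0%R) | u <- enum 'I_n, v <- enum 'I_n])).
  move=> /(mem_nth 0%R)/allpairsP[[u v] [_ _ ->]] /=.
  by case: ifP => // /size_len_leq/leq_trans; apply.
by move=> ?; rewrite nth_default.
Qed.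

End Instance.

(** With the size [L] of the instance as variable: a path has at most [L ^ 3] edges
    of size at most [L], and the remaining terms cover the input itself. *)
Definition memory_bound : {poly nat} :=
  (2%:P * ('X * ('X * 'X) * 'X + 1) + 'X + 1)%R.

Theorem shortest_path_polynomial_time (Pb : ticket_problem K) :
  (forall I (H : seq 'I_(nstations I)),
     shortest_path (network I) (origin I) (destination I) H -> Pb I [:: H]) ->
  computable_in_polynomial_time sz Pb.
Proof.
move=> PbP; exists shortest_path_cmd, (cost_bound shortest_path_cmd \Po memory_bound)%R => I.
set L := instance_size sz I; set n := nstations I.
have nL : n <= L := nstations_leq I.
have XE : (memory_bound.[L])%R = 2 * (L * (L * L) * L).+1 + L + 1.
  by rewrite /memory_bound !horner_natE (addn1 (L * _ * L)).
set X := (memory_bound.[L])%R in XE.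
have LX : L < X by rewrite XE; lia.
have X2 : 2 <= X by rewrite XE; lia.
have nX : n < X := leq_ltn_trans nL LX.
have sS := input_small X2 (ltnW LX).
have sz0 : sz 0%R <= X.
  by have := @sz_sum [::] 0; rewrite big_nil => /(_ _)/leq_trans; apply.
have szP W : is_path (network I) W -> size W <= (n * (n * n)).+1 ->
    sz (path_len (network I) W) <= X.
  move=> pW szW; apply: leq_trans (sz_path_leq (B := L) _ pW szW) _.
    exact: size_len_leq.
  rewrite XE -addnA; apply: leq_trans (leq_addr _ _).
  by rewrite leq_mul2l ltnS /= !leq_mul.
have [||t [s [e lt [H [HP out]]]]] :=
  runs_shortest_path (@weightE I) nX sz0 szP sS erefl erefl erefl _ (fun _ _ _ _ => erefl) _.
- by move=> [|[|[|a]]] //= _; rewrite nth_nil.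
- by move=> u _; apply: input_dist0.
exists [:: H], t, s; split=> //; first exact: PbP.
by rewrite horner_comp.
Qed.

End PolynomialTime.

Theorem corollary52 (R : realType) :
  (computable_in_polynomial_time rat_bit_size (@cheapest_standard_ticket_problem rat)
   /\ computable_in_polynomial_time rat_bit_size (@cheapest_ticket_problem rat))
  /\
  (computable_in_polynomial_time (@unit_size R) (@cheapest_standard_ticket_problem R)
   /\ computable_in_polynomial_time (@unit_size R) (@cheapest_ticket_problem R)).
Proof.
have unit_sum (xs : seq R) B : {in xs, forall x, unit_size x <= B} ->
  unit_size (\sum_(x <- xs) x)%R <= 2 * (size xs * B).+1 by rewrite mulnS.
split; split.
- apply: (shortest_path_polynomial_time rat_bit_size_sum) => I H.
  exact: shortest_path_cheapest_standard_ticket.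
- apply: (shortest_path_polynomial_time rat_bit_size_sum) => I H.
  exact: shortest_path_cheapest_ticket.
- apply: (shortest_path_polynomial_time unit_sum) => I H.
  exact: shortest_path_cheapest_standard_ticket.
- apply: (shortest_path_polynomial_time unit_sum) => I H.
  exact: shortest_path_cheapest_ticket.
Qed.
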